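(* Let $p$ be an $n\times n$ non-negative matrix with ${\rm perm}(p)>0$ and let $\gamma\in[-1,1]$. Suppose $\beta\in\mathcal{B}_p^{(int)}$ and positive reals $w_1,\dots,w_n,w^1,\dots,w^n$ satisfy $$\text{for all } (i,j):\quad \frac{\beta_{ij}}{(1-\beta_{ij})^\gamma}=\frac{p_{ij}}{w_i w^j}.$$ Then $${\rm perm}(p)=Z_f^{(\gamma)}(\beta|p)\,{\rm perm}\left(\beta./(1-\beta).^\gamma\right)\prod_{(i,j)\in\mathcal{E}}(1-\beta_{ij})^\gamma,$$ where $\beta./(1-\beta).^\gamma$ is the $n\times n$ matrix with entries $\beta_{ij}/(1-\beta_{ij})^\gamma$ and $$-\log Z_f^{(\gamma)}(\beta|p)=F_f^{(\gamma)}(\beta|p)=\sum_{(i,j)\in\mathcal{E}}\left(\beta_{ij}\log(\beta_{ij}/p_{ij})+\gamma(1-\beta_{ij})\log(1-\beta_{ij})\right).$$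
   Context: ${\rm perm}(p)=\sum_{s\in S_n}\prod_{i=1}^n p_{i s(i)}$. $\mathcal{E}=\{(i,j): p_{ij}>0\}$. $\mathcal{B}_p$ is the set of doubly stochastic non-negative $n\times n$ matrices $\beta$ with $\beta_{ij}=0$ whenever $p_{ij}=0$; $\mathcal{B}_p^{(int)}$ is the set of $\beta\in\mathcal{B}_p$ with $\beta_{ij}\notin\{0,1\}$ for every $(i,j)$ with $p_{ij}\neq0$. *)

(* Defs.v *)
From mathcomp Require Import all_boot all_order all_fingroup all_algebra.
From mathcomp Require Import reals sequences exp.

Set Implicit Arguments.
Unset Strict Implicit.
Unset Printing Implicit Defensive.

Import Order.TTheory GRing.Theory Num.Theory.
Local Open Scope ring_scope.

Definition permanent (R : realType) (n : nat) (A : 'M[R]_n) : R :=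
  \sum_(s : 'S_n) \prod_(i < n) A i (s i).

Definition nonneg_mx (R : realType) (n : nat) (A : 'M[R]_n) : Prop :=
  forall i j, 0 <= A i j.

Definition doubly_stochastic (R : realType) (n : nat) (b : 'M[R]_n) : Prop :=
  [/\ nonneg_mx b,
      forall i, \sum_(j < n) b i j = 1
    & forall j, \sum_(i < n) b i j = 1].

Definition edges (R : realType) (n : nat) (p : 'M[R]_n) : {set 'I_n * 'I_n} :=
  [set ij | 0 < p ij.1 ij.2].

Definition in_Bp (R : realType) (n : nat) (p b : 'M[R]_n) : Prop :=
  doubly_stochastic b /\ (forall i j, p i j = 0 -> b i j = 0).

Definition in_Bp_int (R : realType) (n : nat) (p b : 'M[R]_n) : Prop :=
  in_Bp p b /\ (forall i j, p i j <> 0 -> b i j <> 0 /\ b i j <> 1).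

(* The fractional free energy F_f^(gamma)(b|p).  The sum ranges over the edges
   only, so that p i j is never a zero denominator. *)
Definition fracF (R : realType) (n : nat) (gamma : R) (b p : 'M[R]_n) : R :=
  \sum_(ij in edges p)
    (b ij.1 ij.2 * ln (b ij.1 ij.2 / p ij.1 ij.2)
     + gamma * (1 - b ij.1 ij.2) * ln (1 - b ij.1 ij.2)).

Definition fracZ (R : realType) (n : nat) (gamma : R) (b p : 'M[R]_n) : R :=
  expR (- fracF gamma b p).

Lemma fracZE (R : realType) (n : nat) (gamma : R) (b p : 'M[R]_n) :
  - ln (fracZ gamma b p) = fracF gamma b p.
Proof. by rewrite /fracZ expRK opprK. Qed.

(* The matrix b ./ (1 - b).^gamma, with entrywise division and power.  For b in
   in_Bp_int every 1 - b i j is positive, so the convention 0 `^ gamma = 0 of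
   powR (for gamma != 0) plays no role. *)
Definition fracmx (R : realType) (n : nat) (gamma : R) (b : 'M[R]_n) : 'M[R]_n :=
  \matrix_(i, j) (b i j / (1 - b i j) `^ gamma).

(* Main.v *)
(** Permanents scale by the row and column factors, so
    [perm p = perm (fracmx gamma b) * \prod_i w i * \prod_j w' j].  Taking
    logarithms in the hypothesis, each edge contributes
    [gamma ln (1 - b i j) - b i j (ln (w i) + ln (w' j))] to the free energy;
    as [b] is doubly stochastic and vanishes off the edges, these terms sum to
    [\sum gamma ln (1 - b i j) - \sum_i ln (w i) - \sum_j ln (w' j)]. *)
Require Import Defs.
From mathcomp Require Import all_boot all_order all_fingroup all_algebra.
From mathcomp Require Import reals sequences exp.
From mathcomp Require Import ring.

Import Order.TTheory GRing.Theory Num.Theory.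
Local Open Scope ring_scope.

(** A permutation meets every row and every column once, so each of its products collects all the
    [u i] and all the [v j]. *)
Lemma permanent_scale (R : realType) (n : nat) (A B : 'M[R]_n)
    (u v : 'I_n -> R) :
  (forall i j, A i j = B i j * (u i * v j)) ->
  permanent A = permanent B * (\prod_i u i * \prod_j v j).
Proof.
move=> AB; rewrite /permanent mulr_suml; apply: eq_bigr => s _.
rewrite (eq_bigr _ (fun i _ => AB i (s i))) !big_split /=.
by rewrite [X in _ = _ * (_ * X)](reindex_inj (@perm_inj _ s)).
Qed.

Lemma doubly_stochastic_le1 (R : realType) (n : nat) (b : 'M[R]_n) i j :
  doubly_stochastic b -> b i j <= 1.
Proof.
case=> b_ge0 row1 _; rewrite -(row1 i) (bigD1 j) //= lerDl.
by apply: sumr_ge0 => k _; exact: b_ge0.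
Qed.

(** Provides the positivity on edges that the rules for [ln] and [powR] require. *)
Lemma in_Bp_int_itv (R : realType) (n : nat) (p b : 'M[R]_n) i j :
  in_Bp_int p b -> 0 < p i j -> 0 < b i j < 1.
Proof.
move=> [[b_ds _] b_int] /lt0r_neq0/eqP /b_int[/eqP b_neq0 /eqP b_neq1].
rewrite !lt_neqAle eq_sym b_neq0 b_neq1 doubly_stochastic_le1 //= andbT.
by case: b_ds => b_ge0 _ _; exact: b_ge0.
Qed.

Lemma sum_edges_in_Bp (R : realType) (n : nat) (p b : 'M[R]_n)
    (f g : 'I_n -> R) :
  nonneg_mx p -> in_Bp p b ->
  \sum_(ij in edges p) b ij.1 ij.2 * (f ij.1 + g ij.2) =
  \sum_i f i + \sum_j g j.
Proof.
move=> p_ge0 [[_ row1 col1] b_supp].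
transitivity (\sum_i \sum_j b i j * (f i + g j)).
  rewrite pair_big /= [RHS](bigID (mem (edges p))) /=.
  rewrite [X in _ = _ + X]big1 ?addr0 // => -[i j] /=.
  (* As [p] is nonnegative, a pair that is not an edge has [p i j = 0]. *)
  rewrite inE /= lt_def p_ge0 andbT negbK => /eqP /b_supp ->.
  by rewrite mul0r.
under eq_bigr => i _ do (under eq_bigr do rewrite mulrDr; rewrite big_split /=).
rewrite big_split /= [X in _ + X]exchange_big /=.
congr (_ + _); apply: eq_bigr => i _.
  by rewrite -mulr_suml row1 mul1r.
by rewrite -mulr_suml col1 mul1r.
Qed.

Lemma edge_energyE (R : realType) (b p w w' gamma : R) :
  0 < b < 1 -> 0 < p -> 0 < w -> 0 < w' ->
  b / (1 - b) `^ gamma = p / (w * w') ->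
  b * ln (b / p) + gamma * (1 - b) * ln (1 - b) =
  gamma * ln (1 - b) - b * (ln w + ln w').
Proof.
move=> /andP[b_gt0 b_lt1] p_gt0 w_gt0 w'_gt0 e.
have c_gt0 : 0 < 1 - b by rewrite subr_gt0.
have cg_gt0 : 0 < (1 - b) `^ gamma by rewrite powR_gt0.
have ww'_gt0 : 0 < w * w' by rewrite mulr_gt0.
have bp : b / p = (1 - b) `^ gamma / (w * w').
  rewrite -[in LHS](divfK (lt0r_neq0 cg_gt0) b) e mulrAC [p / _]mulrC.
  by rewrite (mulfK (lt0r_neq0 p_gt0)) mulrC.
by rewrite bp ln_div ?posrE // ln_powR lnM ?posrE //; ring.
Qed.

Lemma expR_sum_ln (R : realType) (I : finType) (f : I -> R) :
  (forall i, 0 < f i) -> expR (\sum_i ln (f i)) = \prod_i f i.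
Proof.
by move=> f_gt0; rewrite expR_sum; apply: eq_bigr => i _; rewrite lnK ?posrE.
Qed.

Theorem mainTheorem3 (R : realType) (n : nat) (p : 'M[R]_n) (gamma : R)
    (p_ge0 : nonneg_mx p) (perm_gt0 : 0 < permanent p)
    (gamma_bnd : -1 <= gamma <= 1)
    (b : 'M[R]_n) (b_int : in_Bp_int p b)
    (w w' : 'I_n -> R)
    (w_gt0 : forall i, 0 < w i) (w'_gt0 : forall j, 0 < w' j)
    (hw : forall i j, b i j / (1 - b i j) `^ gamma = p i j / (w i * w' j)) :
  permanent p =
    fracZ gamma b p * permanent (fracmx gamma b)
      * \prod_(ij in edges p) (1 - b ij.1 ij.2) `^ gamma.
Proof.
have pE i j : p i j = fracmx gamma b i j * (w i * w' j).
  by rewrite mxE hw divfK // mulf_neq0 ?lt0r_neq0.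
(* Cancelling [permanent (fracmx gamma b)] leaves an identity between products of positive factors,
   proved inside [expR]. *)
rewrite (permanent_scale _ _ _ _ _ _ pE) mulrAC mulrC; congr (_ * _).
have FE : fracF gamma b p =
    \sum_(ij in edges p) gamma * ln (1 - b ij.1 ij.2)
    - (\sum_i ln (w i) + \sum_j ln (w' j)).
  rewrite -(sum_edges_in_Bp _ _ _ _ _ _ p_ge0 b_int.1) -sumrB.
  apply: eq_bigr => -[i j]; rewrite inE /= => pij_gt0.
  by apply: edge_energyE; rewrite ?(in_Bp_int_itv _ _ _ _ _ _ b_int).
have -> : \prod_(ij in edges p) (1 - b ij.1 ij.2) `^ gamma =
    expR (\sum_(ij in edges p) gamma * ln (1 - b ij.1 ij.2)).
  rewrite expR_sum; apply: eq_bigr => -[i j]; rewrite inE /= => pij_gt0.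
  have /andP[_ b_lt1] := in_Bp_int_itv _ _ _ _ _ _ b_int pij_gt0.
  (* A nonzero base selects the exponential branch of [powR]. *)
  by rewrite /powR gt_eqF // subr_gt0.
(* The edge sums cancel in the exponent, leaving only the logarithms of [w] and [w']. *)
by rewrite /fracZ -expRD FE opprB subrK expRD !expR_sum_ln.
Qed.
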